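(* Let $V=\bigoplus_{i\ge0}V^i$ be a vertex operator algebra over $\mathbb{C}$ of CFT-type with a non-degenerate invariant bilinear form $(\cdot|\cdot)$ normalized so that $(\mathbf 1|\mathbf 1)=-1$. Let $c$ be the central charge of $V$ and let $d=\dim V^1$, with $d>0$. Assume that $c\neq 0,-22/5$ and that the fourth Casimir element satisfies $\kappa_4\in V_\omega^4$. Then for all $a_1,a_2,a_3,a_4\in V^1$, \begin{align*} \mathrm{Tr}_{V^1}\, a_{1(0)}a_{2(0)}a_{3(0)}a_{4(0)} =&\Bigl(1+\frac{3d(c-2)}{c(22+5c)}\Bigr)(a_{1(0)}a_{2}|a_{3(0)}a_4)+\Bigl(2-\frac{24d}{c(22+5c)}\Bigr)(a_{1(0)}a_4|a_{2(0)}a_3)\\ &+\frac{24d}{c(22+5c)}\Bigl((a_1|a_2)(a_3|a_4)+(a_1|a_3)(a_2|a_4)+(a_1|a_4)(a_2|a_3)\Bigr). \end{align*}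
   Context: A vertex operator algebra (VOA) $V=\bigoplus_{i=0}^\infty V^i$ over $\mathbb{C}$ has vertex operators $Y(v,z)=\sum_{i\in\mathbb{Z}}v_{(i)}z^{-i-1}$, vacuum vector $\mathbf 1\in V^0$ and conformal vector $\omega\in V^2$; $L(m)=\omega_{(m+1)}$ generate a representation of the Virasoro algebra with central charge $c\in\mathbb{C}$. $V$ is of CFT-type if $V^0=\mathbb{C}\mathbf 1$. Invariant bilinear forms are in the sense of Frenkel--Huang--Lepowsky; with the normalization $(\mathbf 1|\mathbf 1)=-1$ one has $(a|b)\mathbf 1=a_{(1)}b$ for $a,b\in V^1$. The space $V^1$ is a Lie algebra with bracket $[a,b]=a_{(0)}b$, and $a_{(0)}$ ($a\in V^1$) acts on $V^1$. $V_\omega$ is the subVOA generated by $\omega$, and $V_\omega^i=V_\omega\cap V^i$. For a basis $x^1,\dots,x^d$ of $V^1$ with dual basis $x_1,\dots,x_d$ with respect to $(\cdot|\cdot)$, the $i$-th Casimir element is $\kappa_i=\sum_{j=1}^d x^j_{(1-i)}x_j\in V^i$ (independent of the choice of basis). *)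

(* Defs.v *)
From HB Require Import structures.
From mathcomp Require Import all_boot all_order all_algebra.
From mathcomp Require Import boolp classical_sets reals complex.

Set Implicit Arguments.
Unset Strict Implicit.
Unset Printing Implicit Defensive.

Import Order.TTheory GRing.Theory Num.Theory.

Local Open Scope ring_scope.

Section Subspace.
Context (K : fieldType) (V : lmodType K).

Definition subspace_basis (U : {pred V}) (d : nat) (x : 'I_d -> V) : Prop :=
  [/\ forall i, x i \in U,
      forall u, u \in U -> exists a : 'I_d -> K, u = \sum_i a i *: x i
    & forall a : 'I_d -> K, \sum_i a i *: x i = 0 -> forall i, a i = 0].

(* The trace on U of f is that of its matrix in any finite basis of U. The
   value is 0 when U has no finite basis or is not stable under f. *)
Definition subspace_trace (U : {pred V}) (f : V -> V) : K :=
  xget 0 [set t | exists d (x : 'I_d -> V) (M : 'M[K]_d),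
    [/\ subspace_basis U x, forall j, f (x j) = \sum_i M i j *: x i
      & t = \tr M]]%classic.

End Subspace.

(* The coefficient of z^j in (1 + z)^m, for m possibly negative. *)
Definition binz (K : fieldType) (m : int) (j : nat) : K :=
  (\prod_(i < j) (m - i%:Z)%:~R) / (j`!)%:R.

(* Vertex operator algebras over R[i], for R the field of real numbers, as
   defined by Frenkel, Huang and Lepowsky, with grading supported in
   nonnegative degrees. *)
Record voa (R : realType) := VOA {
  voa_sort :> lmodType R[i];
  grade : nat -> {pred voa_sort};
  (* [mode n a b] is a_(n) b. *)
  mode : int -> {bilinear voa_sort -> voa_sort -> voa_sort};
  vacuum : voa_sort;
  conformal : voa_sort;
  central_charge : R[i];

  grade_submod : forall i, submod_closed (grade i);
  grade_fin_dim : forall i,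
    exists d (x : 'I_d -> voa_sort), subspace_basis (grade i) x;
  grade_span : forall v : voa_sort, exists n (u : nat -> voa_sort),
    (forall i, u i \in grade i) /\ v = \sum_(i < n) u i;
  grade_direct : forall n (u : nat -> voa_sort),
    (forall i, u i \in grade i) ->
    \sum_(i < n) u i = 0 -> forall i, (i < n)%N -> u i = 0;
  vacuum_grade : vacuum \in grade 0;
  conformal_grade : conformal \in grade 2;

  mode_truncation : forall a b : voa_sort,
    exists N : int, forall n : int, N <= n -> mode n a b = 0;
  vacuum_mode : forall (n : int) (a : voa_sort),
    mode n vacuum a = if n == -1 then a else 0;
  vacuum_creation : forall a : voa_sort, mode (-1) a vacuum = a;
  vacuum_annihilation : forall (n : int) (a : voa_sort),
    0 <= n -> mode n a vacuum = 0;
  (* The Jacobi identity in components. By truncation both sides are finite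
     sums, so they are the common value of all large enough partial sums. *)
  mode_borcherds : forall (a b u : voa_sort) (m n k : int),
    exists N0 : nat, forall N : nat, (N0 <= N)%N ->
      \sum_(j < N) binz _ m j *: mode (m + k - j%:Z) (mode (n + j%:Z) a b) u =
      \sum_(j < N) ((-1) ^+ j * binz _ n j) *:
        (mode (m + n - j%:Z) a (mode (k + j%:Z) b u)
         - (-1) ^ n *: mode (n + k - j%:Z) b (mode (m + j%:Z) a u));

  virasoro : forall (m n : int) (v : voa_sort),
    mode (m + 1) conformal (mode (n + 1) conformal v)
    - mode (n + 1) conformal (mode (m + 1) conformal v) =
    (m - n)%:~R *: mode (m + n + 1) conformal v
    + (if m + n == 0 then (m ^+ 3 - m)%:~R / 12 * central_charge else 0)
        *: v;
  conformal_weight : forall (i : nat) (v : voa_sort),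
    v \in grade i -> mode 1 conformal v = i%:R *: v;
  conformal_derivation : forall (a b : voa_sort) (n : int),
    mode n (mode 0 conformal a) b = (- n)%:~R *: mode (n - 1) a b
}.

Arguments grade {R} V i : rename.
Arguments mode {R V} n : rename.
Arguments vacuum {R} V : rename.
Arguments conformal {R} V : rename.
Arguments central_charge {R} V : rename.

Section VOATheory.
Context (R : realType) (V : voa R).

Definition virasoro_op (m : int) (v : V) : V := mode (m + 1) (conformal V) v.

Definition cft_type : Prop :=
  forall v : V, v \in grade V 0 <-> exists l : R[i], v = l *: vacuum V.

(* The coefficient of z^(-n-1) in
     (Y(a,z)u | v) = (u | Y(e^(z L(1)) (-z^(-2))^L(0) a, z^(-1)) v)
   for a of degree k. The exponential stops at j = k since L(1) lowers the
   degree by 1. *)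
Definition invariant_form (B : {biscalar V}) : Prop :=
  forall (k : nat) (a u v : V) (n : int), a \in grade V k ->
    B (mode n a u) v =
    (-1) ^+ k * \sum_(j < k.+1) (j`!)%:R^-1 *
      B u (mode (k.*2%:Z - n - j%:Z - 2) (iter j (virasoro_op 1) a) v).

Definition nondegenerate_form (B : {biscalar V}) : Prop :=
  (forall u, (forall v, B u v = 0) -> u = 0) /\
  (forall v, (forall u, B u v = 0) -> v = 0).

Definition sub_voa (W : {pred V}) : Prop :=
  [/\ submod_closed W, vacuum V \in W, conformal V \in W
    & forall (n : int) a b, a \in W -> b \in W -> mode n a b \in W].

Definition conformal_sub_voa : {pred V} :=
  [pred v | `[< forall W : {pred V}, sub_voa W -> v \in W >]].

Definition conformal_sub_voa_grade (i : nat) : {pred V} :=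
  [predI conformal_sub_voa & grade V i].

Definition dual_basis (U : {pred V}) (B : {biscalar V}) d (x y : 'I_d -> V) :
    Prop :=
  [/\ subspace_basis U x, subspace_basis U y
    & forall i j, B (x i) (y j) = (i == j)%:R].

Definition casimir d (x y : 'I_d -> V) (i : nat) : V :=
  \sum_(j < d) mode (1 - i%:Z) (x j) (y j).

End VOATheory.

Arguments conformal_sub_voa {R} V.
Arguments conformal_sub_voa_grade {R} V i.

(* Main.v *)
Require Import Defs.
From mathcomp Require Import all_boot all_order all_algebra.
From mathcomp Require Import boolp classical_sets reals complex.
From mathcomp Require Import zify ring.
Import Order.TTheory GRing.Theory Num.Theory.
Local Open Scope ring_scope.

(** The trace is read off from one vector of degree 0 computed in two ways.
    Write [g] for the degree 1 part, [[a b] = a_(0) b], and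
<<
      F(v) = a1_(1) a2_(1) a3_(1) a4_(1) v        (v of degree 4),
>>
    a multiple of the vacuum.

    For [a] in [g] one has [L(1) a = 0] and [a_(1) b = (a|b) 1], so the modes of
    [g] obey the affine relations
    [a_(m) b_(n) - b_(n) a_(m) = [a b]_(m+n) + m (a|b) delta_(m+n,0)].
    Pushing the four operators through [x_(-3) y] and summing over dual bases,
    the term in which all four of them hit [x] is the trace [T], and every other
    term collapses, since [sum_j (a|x_j) x^j = a], to a pairing of brackets
    ([four_currents_casimir]).

    On the other side, the degree 4 part of the subalgebra generated by the
    conformal vector is spanned by [L(-2)^2 1] and [L(-4) 1]
    ([conformal_sub_voa_grade4]), so
    [kappa_4 = alpha L(-2)^2 1 + beta L(-4) 1]. Applying [L(4)] and [L(2)^2],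
    which are easy on [x_(-3) y], gives a linear system for [alpha] and [beta]
    whose determinant is a nonzero multiple of [c^2 (22 + 5c)]:
<<
      alpha = 12 d / (c (22 + 5c)),   beta = 3 d (c + 2) / (c (22 + 5c)).
>>
    The values of [F] on the two spanning vectors follow from the same
    commutation relations ([four_currents_lower4], [four_currents_lower22]).
    With [P = ([a1 a2]|[a3 a4])], [Q = ([a1 a4]|[a2 a3])],
    [S = ([a1 a3]|[a2 a4])] and [Sigma] the sum of the three products of
    scalar pairings, equating both values of [F(kappa_4)] reads
<<
      T - S - Q = alpha (2 Sigma - Q - S) + beta P,
>>
    and the Jacobi identity [S = P + Q] turns this into the stated formula. *)

Set Implicit Arguments.
Unset Strict Implicit.
Unset Printing Implicit Defensive.

(** * Traces on a subspace and dual bases *)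

Section Trace.
Context (K : fieldType) (V : lmodType K).

Lemma comb_mulmx (m n p : nat) (x : 'I_m -> V) (A : 'M[K]_(m, n))
    (C : 'M[K]_(n, p)) j :
  \sum_i C i j *: (\sum_k A k i *: x k) = \sum_k (A *m C) k j *: x k.
Proof.
under eq_bigr do rewrite scaler_sumr.
rewrite exchange_big /=; apply: eq_bigr => k _; rewrite mxE scaler_suml.
by apply: eq_bigr => i _; rewrite scalerA mulrC.
Qed.

Lemma comb_mx1 (m : nat) (x : 'I_m -> V) j :
  \sum_k (1%:M : 'M[K]_m) k j *: x k = x j.
Proof.
rewrite (bigD1 j) //= mxE eqxx scale1r big1 ?addr0 // => k kj.
by rewrite mxE (negbTE kj) scale0r.
Qed.

Lemma basis_coord_inj (U : {pred V}) m n (x : 'I_m -> V) (A C : 'M[K]_(m, n)) :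
  subspace_basis U x ->
  (forall j, \sum_k A k j *: x k = \sum_k C k j *: x k) -> A = C.
Proof.
move=> [_ _ x_free] eqAC; apply/matrixP => i j; apply/eqP.
rewrite -subr_eq0; apply/eqP; apply: (x_free (fun k => A k j - C k j)).
under eq_bigr do rewrite scalerBl.
by rewrite sumrB eqAC subrr.
Qed.

Lemma basis_coord (U : {pred V}) m n (x : 'I_m -> V) (u : 'I_n -> V) :
  subspace_basis U x -> (forall j, u j \in U) ->
  exists A : 'M[K]_(m, n), forall j, u j = \sum_k A k j *: x k.
Proof.
move=> [_ x_span _] uU.
have /fin_all_exists[a aP] : forall j, exists a : 'I_m -> K,
  u j = \sum_k a k *: x k by move=> j; apply: x_span.
exists (\matrix_(k, j) a j k) => j; rewrite aP.
by apply: eq_bigr => k _; rewrite mxE.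
Qed.

(** Two bases are related by mutually inverse, possibly rectangular, matrices
    [P] and [Q], and [M' = Q M P]; hence [xget] picks from a single value in
    the definition of the trace. *)
Lemma subspace_trace_unique (U : {pred V}) (f : {linear V -> V}) m n
    (x : 'I_m -> V) (x' : 'I_n -> V) (M : 'M[K]_m) (M' : 'M[K]_n) :
  subspace_basis U x -> subspace_basis U x' ->
  (forall j, f (x j) = \sum_i M i j *: x i) ->
  (forall j, f (x' j) = \sum_i M' i j *: x' i) ->
  \tr M' = \tr M.
Proof.
move=> bx bx' fx fx'.
have [xU _ _] := bx; have [x'U _ _] := bx'.
have [P PE] := basis_coord bx x'U; have [Q QE] := basis_coord bx' xU.
have PQ : P *m Q = 1%:M.
  apply: (basis_coord_inj bx) => j; rewrite comb_mx1 -comb_mulmx [RHS]QE.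
  by apply: eq_bigr => i _; rewrite -PE.
have QP : Q *m P = 1%:M.
  apply: (basis_coord_inj bx') => j; rewrite comb_mx1 -comb_mulmx [RHS]PE.
  by apply: eq_bigr => i _; rewrite -QE.
have MP : M *m P = P *m M'.
  apply: (basis_coord_inj bx) => j; rewrite -!comb_mulmx.
  transitivity (f (x' j)).
    by rewrite PE linear_sum; apply: eq_bigr => i _; rewrite linearZ /= fx.
  by rewrite fx'; apply: eq_bigr => i _; rewrite -PE.
by rewrite -[M']mul1mx -QP -mulmxA -MP mxtrace_mulC -mulmxA PQ mulmx1.
Qed.

Lemma subspace_trace_dual (U : {pred V}) (B : {biscalar V})
    (f : {linear V -> V}) d (x y : 'I_d -> V) :
  subspace_basis U x -> (forall i j, B (x i) (y j) = (i == j)%:R) ->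
  (forall u, u \in U -> f u \in U) ->
  subspace_trace U f = \sum_j B (f (x j)) (y j).
Proof.
move=> bx xy fU; have [xU _ _] := bx.
have [M ME] := basis_coord bx (fun j => fU _ (xU j)).
have -> : \sum_j B (f (x j)) (y j) = \tr M.
  apply: eq_bigr => j _; rewrite ME linear_sumlz (bigD1 j) //= big1.
    by rewrite addr0 linearZl_LR xy eqxx; exact: mulr1.
  by move=> i ij; rewrite linearZl_LR xy (negbTE ij); exact: mulr0.
apply: xget_unique; first by exists d, x, M.
by move=> _ [d' [x' [M' [bx' fx' ->]]]]; apply: (subspace_trace_unique bx bx').
Qed.

End Trace.

(** * Commutators, iterates and the grading *)

Section Binz.
Context (K : fieldType).

Lemma binz0 (m : int) : binz K m 0 = 1.
Proof. by rewrite /binz big_ord0 fact0 divr1. Qed.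

Lemma binz1 (m : int) : binz K m 1 = m%:~R.
Proof. by rewrite /binz big_ord1 subr0 divr1. Qed.

Lemma binz_small (m j : nat) : (m < j)%N -> binz K m%:Z j = 0.
Proof.
by move=> mj; rewrite /binz (bigD1 (Ordinal mj)) //= subrr !mul0r.
Qed.

End Binz.

Section Modes.
Context (R : realType) (V : voa R).
Implicit Types (a b u v : V) (m n k : int).

Let K := (R[i])%C.

(** The case [m = 0] of the Jacobi identity, which expresses the modes of
    [a_(n) b] by those of [a] and [b]. *)
Lemma mode_iterate a b u n k : exists N : nat,
  mode k (mode n a b) u = \sum_(j < N) ((-1) ^+ j * binz _ n j) *:
    (mode (n - j%:Z) a (mode (k + j%:Z) b u)
     - (-1) ^ n *: mode (n + k - j%:Z) b (mode j%:Z a u)).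
Proof.
have [N0 /(_ N0.+1 (leqnSn _)) E] := mode_borcherds a b u 0 n k.
exists N0.+1; move: E; rewrite big_ord_recl big1 /=; last first.
  by move=> i _; rewrite binz_small ?scale0r.
rewrite addr0 binz0 scale1r add0r subr0 addr0 => ->.
by apply: eq_bigr => j _; rewrite !add0r.
Qed.

(** The case [n = 0] of the Jacobi identity. The number [N] of terms is chosen
    by the user, who only has to see that later terms vanish. *)
Lemma mode_commutator N a b u m k :
  (forall j : nat, (N <= j)%N ->
     binz K m j *: mode (m + k - j%:Z) (mode j%:Z a b) u = 0) ->
  mode m a (mode k b u) - mode k b (mode m a u) =
  \sum_(j < N) binz K m j *: mode (m + k - j%:Z) (mode j%:Z a b) u.
Proof.
move=> tail0; have [N0] := mode_borcherds a b u m 0 k.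
move=> /(_ (maxn N N0).+1 (leqW (leq_maxr _ _))).
rewrite [X in _ = X]big_ord_recl [X in _ = _ + X]big1 /=; last first.
  by move=> i _; rewrite (@binz_small _ 0) // mulr0 scale0r.
rewrite binz0 mulr1 expr0 !scale1r !addr0 add0r => <-.
rewrite (big_ord_widen _ (fun j => binz K m j *:
  mode (m + k - j%:Z) (mode j%:Z a b) u) (leqW (leq_maxl N N0))).
rewrite [RHS]big_mkcond /=; apply: eq_bigr => j _; rewrite add0r.
by case: ltnP => // /tail0.
Qed.

Lemma grade0 i : 0 \in grade V i.
Proof. by have [] := @grade_submod R V i. Qed.

Lemma gradeZ i l v : v \in grade V i -> l *: v \in grade V i.
Proof.
have [z0 lin] := @grade_submod R V i.
by move=> vi; rewrite -[l *: v]addr0 lin.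
Qed.

Lemma gradeD i u v : u \in grade V i -> v \in grade V i -> u + v \in grade V i.
Proof.
by have [_ lin] := @grade_submod R V i => ui vi; rewrite -[u]scale1r lin.
Qed.

(** Since [L(0)] is multiplication by [i] on degree [i] and the degrees are in
    direct sum, an eigenvector of [L(0)] has no component of another weight. *)
Lemma weight_components (l : K) (n : nat) (u : nat -> V) :
  (forall i, u i \in grade V i) ->
  mode 1 (conformal V) (\sum_(i < n) u i) = l *: \sum_(i < n) u i ->
  forall i, (i < n)%N -> i%:R != l -> u i = 0.
Proof.
move=> uh; rewrite linear_sumr scaler_sumr => /eqP.
rewrite -subr_eq0 -sumrB => /eqP E i ltin neq.
have uE j : mode 1 (conformal V) (u j) - l *: u j = (j%:R - l) *: u j.
  by rewrite (conformal_weight (uh j)) scalerBl.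
have wh j : (j%:R - l) *: u j \in grade V j by apply/gradeZ/uh.
have /(_ i ltin)/eqP := grade_direct (n := n) wh (etrans (esym (eq_bigr _
  (fun (j : 'I_n) _ => uE j))) E).
by rewrite scaler_eq0 subr_eq0 (negbTE neq) => /eqP.
Qed.

Lemma weight_grade i v :
  mode 1 (conformal V) v = i%:R *: v -> v \in grade V i.
Proof.
have [n [u [uh ->]]] := grade_span v => /(weight_components uh) u0.
apply: (big_ind (fun w => w \in grade V i)) => [||j _]; first exact: grade0.
  by move=> *; apply: gradeD.
have [<- //|ne] := eqVneq (val j) i.
by rewrite u0 ?grade0 // eqr_nat.
Qed.

Lemma weight_neg (i : nat) v :
  mode 1 (conformal V) v = (- i.+1%:R) *: v -> v = 0.
Proof.
have [n [u [uh ->]]] := grade_span v => /(weight_components uh) u0.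
rewrite big1 // => j _; apply: u0 => //.
by rewrite -addr_eq0 -natrD pnatr_eq0 addnS.
Qed.

(** From [[L(0), a_(n)] = (L(0) a)_(n) + (L(-1) a)_(n+1)], the last term being
    [- (n + 1) a_(n)]. This is how the grading of the modes follows from the
    weights alone. *)
Lemma mode_weight a b (i j : nat) n :
  a \in grade V i -> b \in grade V j ->
  mode 1 (conformal V) (mode n a b) = (i%:Z + j%:Z - n - 1)%:~R *: mode n a b.
Proof.
move=> ai bj.
have := mode_commutator (N := 2) (a := conformal V) (b := a) (u := b)
  (m := 1) (k := n) _.
rewrite big_ord_recl big_ord1 /= binz0 binz1 !scale1r => /(_ _)/eqP.
rewrite (conformal_weight ai) conformal_derivation subr_eq => /(_ _)/eqP -> //.
  rewrite (conformal_weight bj) linearZr_LR linearZl_LR /=.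
  have -> : 1 + n - 0 - 1 = n by lia.
  have -> : 1 + n - 1 = n by lia.
  rewrite -!scalerDl; congr (_ *: _); rewrite !rmorphB !rmorphD /= !rmorphN /=.
  rewrite !rmorphD /=; ring.
by move=> k k2; rewrite (@binz_small _ 1) ?scale0r.
Qed.

Lemma mode_grade a b (i j k : nat) n :
  a \in grade V i -> b \in grade V j -> k%:Z = i%:Z + j%:Z - n - 1 ->
  mode n a b \in grade V k.
Proof.
by move=> ai bj E; apply: weight_grade; rewrite (mode_weight _ ai bj) -E.
Qed.

Lemma mode_grade_neg a b (i j : nat) n :
  a \in grade V i -> b \in grade V j -> i%:Z + j%:Z <= n -> mode n a b = 0.
Proof.
move=> ai bj le; apply: (@weight_neg (absz (n - i%:Z - j%:Z)%R)).

rewrite (mode_weight _ ai bj); congr (_ *: _).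
transitivity ((- (absz (n - i%:Z - j%:Z)%R).+1%:Z)%:~R : K).
  by congr (_%:~R); lia.
by rewrite rmorphN.
Qed.

End Modes.

(** * The Virasoro vacuum module in degree 4 *)

Section VirasoroSpan.
Context (R : realType) (V : voa R).
Implicit Types (a b u v : V) (m n k : int).

Local Notation L m := (virasoro_op (V := V) m).
Local Notation c := (central_charge V).

Lemma virasoro_op_comm m n v :
  L m (L n v) = L n (L m v) + (m - n)%:~R *: L (m + n) v
    + (if m + n == 0 then (m ^+ 3 - m)%:~R / 12 * c else 0) *: v.
Proof.
by rewrite -addrA -(virasoro m n v) addrC subrK.
Qed.

Lemma virasoro_op_vacuum m : -1 <= m -> L m (vacuum V) = 0.
Proof. by move=> m_ge; apply: vacuum_annihilation; lia. Qed.

Lemma virasoro_op_grade m (i j : nat) v :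
  v \in grade V i -> j%:Z = i%:Z - m -> L m v \in grade V j.
Proof.
by move=> vi E; apply: mode_grade (conformal_grade V) vi _; lia.
Qed.

(** Only the operators [L(n)] with [n <= -2] are used to generate: this makes
    the degree of each generated vector visible, and closure under all of the
    [L(m)] is a theorem. *)
Inductive virasoro_span : V -> Prop :=
| virasoro_span_vacuum : virasoro_span (vacuum V)
| virasoro_span_comb l u v :
    virasoro_span u -> virasoro_span v -> virasoro_span (l *: u + v)
| virasoro_span_lower (i : nat) v :
    virasoro_span v -> virasoro_span (L (- i.+2%:Z) v).

Lemma virasoro_span0 : virasoro_span 0.
Proof.
have sv := virasoro_span_vacuum.
by rewrite -(addNr (vacuum V)) -scaleN1r; apply: virasoro_span_comb.
Qed.

Lemma virasoro_spanZ l v : virasoro_span v -> virasoro_span (l *: v).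
Proof.
move=> sv; rewrite -[l *: v]addr0.
exact: virasoro_span_comb sv virasoro_span0.
Qed.

Lemma virasoro_spanD u v :
  virasoro_span u -> virasoro_span v -> virasoro_span (u + v).
Proof. by move=> su sv; rewrite -[u]scale1r; apply: virasoro_span_comb. Qed.

(** Normal ordering: an [L(m)] with [m >= -1] is moved to the right until it
    kills the vacuum. A commutator with [L(-i-2)] leaves [L(m-i-2)], which is
    again a generator or falls under the induction hypothesis, stated for all
    [m >= -1]. *)
Lemma virasoro_span_op m v : virasoro_span v -> virasoro_span (L m v).
Proof.
move=> sv; have [lt|ge] := ltP m (-1).
  have -> : m = - (absz m).-2.+2%:Z by lia.
  exact: virasoro_span_lower.
elim: sv m ge => {v} [|l u v _ IHu _ IHv|i v sv IH] m ge.
- by rewrite virasoro_op_vacuum //; apply: virasoro_span0.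
- rewrite /virasoro_op linearPr.
  by apply: virasoro_span_comb; [apply: IHu | apply: IHv].
rewrite virasoro_op_comm; apply: virasoro_spanD; last exact: virasoro_spanZ.
apply: virasoro_spanD; first by apply/virasoro_span_lower/IH.
apply: virasoro_spanZ; have [lt|/IH//] := ltP (m + - i.+2%:Z) (-1).
have -> : m - i.+2%:Z = - (absz (m - i.+2%:Z)).-2.+2%:Z by lia.
exact: virasoro_span_lower.
Qed.

(** The left argument is built from the vacuum by modes of the conformal
    vector, and the iterate formula trades each of them for modes applied
    directly, under which the span is stable. *)
Lemma virasoro_span_mode n a b :
  virasoro_span a -> virasoro_span b -> virasoro_span (mode n a b).
Proof.
move=> sa; elim: sa n b => {a} [|l u v _ IHu _ IHv|i v _ IH] n b sb.
- by rewrite vacuum_mode; case: ifP => _ //; apply: virasoro_span0.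
- by rewrite linearPl; apply: virasoro_span_comb; [apply: IHu | apply: IHv].
have sw m u : virasoro_span u -> virasoro_span (mode m (conformal V) u).
  by move=> /(virasoro_span_op (m - 1)); rewrite /virasoro_op subrK.
have [N ->] := mode_iterate (conformal V) v b (- i.+2%:Z + 1) n.
apply: (big_ind virasoro_span) => [||j _]; first exact: virasoro_span0.
  by move=> *; apply: virasoro_spanD.
apply: virasoro_spanZ; apply: virasoro_spanD; first by apply/sw/IH.
by rewrite -scaleNr; apply/virasoro_spanZ/IH/sw.
Qed.

Lemma lower_vacuum : L (-2) (vacuum V) = conformal V.
Proof. exact: vacuum_creation. Qed.

Lemma virasoro_span_sub_voa :
  sub_voa [pred v : V | `[< virasoro_span v >]].
Proof.
split=> [|||n a b].
- split=> [|l u v]; first exact/asboolT/virasoro_span0.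
  by rewrite !inE; apply: virasoro_span_comb.
- exact/asboolT/virasoro_span_vacuum.
- rewrite inE -lower_vacuum; apply: (virasoro_span_lower 0).
  exact: virasoro_span_vacuum.
by rewrite !inE; apply: virasoro_span_mode.
Qed.

(** An upper bound for the degree [i] part of [virasoro_span]. Degrees 3 and
    above 4 are left free: a lowering operator sends them to degree at least 5,
    so they never contribute to degree 4. *)
Definition virasoro_piece (i : nat) (v : V) : Prop :=
  v \in grade V i /\
  match i with
  | 0 => exists l, v = l *: vacuum V
  | 1 => v = 0
  | 2 => exists l, v = l *: conformal V
  | 4 => exists l l', v = l *: L (-2) (conformal V) + l' *: L (-4) (vacuum V)
  | _ => True
  end.

Lemma virasoro_piece0 i : virasoro_piece i 0.
Proof.
split; first exact: grade0.
case: i => [|[|[|[|[|i]]]]] //; first by exists 0; rewrite scale0r.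
  by exists 0; rewrite scale0r.
by exists 0, 0; rewrite !scale0r addr0.
Qed.

Lemma virasoro_piece_comb i l u v :
  virasoro_piece i u -> virasoro_piece i v -> virasoro_piece i (l *: u + v).
Proof.
move=> [ui up] [vi vp]; split; first by apply/gradeD/vi/gradeZ.
case: i up vp {ui vi} => [|[|[|[|[|i]]]]] //.
- by move=> [p ->] [q ->]; exists (l * p + q); rewrite scalerDl scalerA.
- by move=> -> ->; rewrite scaler0 addr0.
- by move=> [p ->] [q ->]; exists (l * p + q); rewrite scalerDl scalerA.
move=> [p [p' ->]] [q [q' ->]]; exists (l * p + q), (l * p' + q').
by rewrite !scalerDl scalerDr !scalerA addrACA.
Qed.

Lemma virasoro_piece_lower i (n : nat) v :
  virasoro_piece i v -> virasoro_piece (i + n.+2) (L (- n.+2%:Z) v).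
Proof.
move=> [vi vp]; split; first by apply: virasoro_op_grade vi _; lia.
case: i vp {vi} => [|[|[|i]]]; last by rewrite !(addnS, addSn).
- move=> [l ->]; rewrite [L _ _]linearZr_LR.
  case: n => [|[|[|n]]] //; first by exists l; rewrite [mode _ _ _]lower_vacuum.
  by exists 0, l; rewrite scale0r add0r.
- move=> ->; rewrite [L _ _]linear0r.
  by case: n => [|[|n]] //; exists 0, 0; rewrite !scale0r addr0.
move=> [l ->]; rewrite [L _ _]linearZr_LR.
by case: n => [|n] //; exists l, 0; rewrite scale0r addr0.
Qed.

(** The decomposition is asked for all large enough [n] so that those of two
    vectors can be added over a common range. *)
Lemma virasoro_span_pieces v : virasoro_span v ->
  exists (N : nat) (u : nat -> V), (forall i, virasoro_piece i (u i)) /\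
    forall n : nat, (N <= n)%N -> v = \sum_(i < n) u i.
Proof.
elim=> {v} [|l u v _ [N [f [fp fE]]] _ [N' [g [gp gE]]]|n v _ [N [f [fp fE]]]].
- exists 1, (fun i => if i is 0 then vacuum V else 0); split=> [[|i]|[//|n] _].
  + by split; [exact: vacuum_grade | exists 1; rewrite scale1r].
  + exact: virasoro_piece0.
  by rewrite big_ord_recl /= big1 ?addr0.
- exists (maxn N N'), (fun i => l *: f i + g i); split=> [i|n].
    exact: virasoro_piece_comb.
  rewrite geq_max => /andP[/fE -> /gE ->].
  by rewrite big_split /= scaler_sumr.
exists (n.+2 + N)%N,
  (fun i => if (i < n.+2)%N then 0 else L (- n.+2%:Z) (f (i - n.+2)%N)).
split=> [i|k Nk].
  case: ltnP => [_|le]; first exact: virasoro_piece0.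
  by rewrite -{1}(subnK le); apply: virasoro_piece_lower.
have -> : k = (n.+2 + (k - n.+2))%N by lia.
rewrite big_split_ord /= big1 ?add0r; last by move=> i _; rewrite ltn_ord.
rewrite {1}(fE (k - n.+2)%N); last by lia.
rewrite [L _ _]linear_sumr; apply: eq_bigr => i _.
by rewrite ltnNge leq_addr /= addKn.
Qed.

Lemma conformal_sub_voa_grade4 v : v \in conformal_sub_voa_grade V 4 ->
  exists l l', v = l *: L (-2) (conformal V) + l' *: L (-4) (vacuum V).
Proof.
rewrite !inE => /andP[/asboolW/(_ _ virasoro_span_sub_voa)].
rewrite inE => /virasoro_span_pieces[N [u [up /(_ N (leqnn _)) ->]]].
move=> /conformal_weight/(weight_components (fun i => (up i).1)) u0.
suff [] : virasoro_piece 4 (\sum_(i < N) u i) by [].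
apply: (big_ind (virasoro_piece 4)) => [||i _]; first exact: virasoro_piece0.
  by move=> w w' wp wp'; rewrite -[w]scale1r; apply: virasoro_piece_comb.
have [<-//|ne] := eqVneq (val i) 4%N.
by rewrite u0 ?eqr_nat //; exact: virasoro_piece0.
Qed.

End VirasoroSpan.

(** * Virasoro operators on the degree 4 vectors *)

Section VirasoroValues.
Context (R : realType) (V : voa R).
Local Notation L m := (virasoro_op (V := V) m).
Local Notation c := (central_charge V).

Lemma L0_conformal : L 0 (conformal V) = 2 *: conformal V.
Proof.
by rewrite /virasoro_op add0r (conformal_weight (conformal_grade V)).
Qed.

Lemma L1_conformal : L 1 (conformal V) = 0.
Proof.
rewrite -lower_vacuum virasoro_op_comm !virasoro_op_vacuum // scale0r.
by rewrite [L _ _]linear0r scaler0 !addr0.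
Qed.

Lemma L2_conformal : L 2 (conformal V) = (c / 2) *: vacuum V.
Proof.
rewrite -lower_vacuum virasoro_op_comm !virasoro_op_vacuum //=.
by rewrite [L _ _]linear0r scaler0 !add0r; congr (_ *: _); field.
Qed.

Lemma L4_conformal : L 4 (conformal V) = 0.
Proof.
rewrite -lower_vacuum virasoro_op_comm !virasoro_op_vacuum // scale0r.
by rewrite [L _ _]linear0r scaler0 !addr0.
Qed.

Lemma L4_lower4 : L 4 (L (-4) (vacuum V)) = (5 * c) *: vacuum V.
Proof.
rewrite virasoro_op_comm !virasoro_op_vacuum //=.
by rewrite [L _ _]linear0r scaler0 !add0r; congr (_ *: _); field.
Qed.

Lemma L4_lower22 : L 4 (L (-2) (conformal V)) = (3 * c) *: vacuum V.
Proof.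
rewrite virasoro_op_comm L4_conformal /= L2_conformal scale0r addr0.
by rewrite [L _ _]linear0r add0r scalerA; congr (_ *: _); field.
Qed.

Lemma L22_lower4 : L 2 (L 2 (L (-4) (vacuum V))) = (3 * c) *: vacuum V.
Proof.
rewrite [L 2 (L (-4) _)]virasoro_op_comm virasoro_op_vacuum //= scale0r addr0.
rewrite [L (-4) _]linear0r add0r lower_vacuum [L _ _]linearZr_LR /=.
by rewrite [mode _ _ _]L2_conformal scalerA; congr (_ *: _); field.
Qed.

Lemma L22_lower22 :
  L 2 (L 2 (L (-2) (conformal V))) = ((8 + c) * c / 2) *: vacuum V.
Proof.
rewrite [L 2 (L (-2) _)]virasoro_op_comm L2_conformal /= L0_conformal.
rewrite [L (-2) _]linearZr_LR /= [mode _ _ _]lower_vacuum scalerA -!scalerDl.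
rewrite [L _ _]linearZr_LR /= [mode _ _ _]L2_conformal scalerA.
by congr (_ *: _); field.
Qed.

End VirasoroValues.

(** * The affine Lie algebra of the degree 1 part *)

Section WeightOne.
Context (R : realType) (V : voa R) (B : {biscalar V}).
Context (cftV : cft_type V) (invB : invariant_form B)
  (B11 : B (vacuum V) (vacuum V) = -1).
Implicit Types (a b u v : V) (m n : int).

Local Notation L m := (virasoro_op (V := V) m).
Local Notation c := (central_charge V).
Local Notation g := (grade V 1).

(** [L(1) a] is a multiple of the vacuum, and by invariance its pairing with
    the vacuum is [(a | L(-1) 1) = 0]. *)
Lemma L1_weight1 a : a \in g -> L 1 a = 0.
Proof.
move=> ag; have /cftV[l lE] : L 1 a \in grade V 0.
  exact: virasoro_op_grade ag _.
have := invB a (vacuum V) 2 (conformal_grade V).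
rewrite big1 ?mulr0 => [|[[|j] /= _] _]; last first.
- rewrite -iterS iterSr L1_conformal iter_fix ?linear0l ?linear0r ?mulr0 //.
  by rewrite /virasoro_op linear0r.
- by rewrite vacuum_annihilation // linear0r mulr0.
rewrite [mode _ _ _]lE linearZl_LR B11 /= => /eqP.
by rewrite mulrN1 oppr_eq0 lE => /eqP ->; rewrite scale0r.
Qed.

Lemma form_weight1 a u v n : a \in g ->
  B (mode n a u) v = - B u (mode (- n) a v).
Proof.
move=> ag; rewrite (invB u v n ag) expr1 mulN1r big_ord_recl big_ord1 /=.
rewrite L1_weight1 // linear0l linear0r mulr0 addr0 invr1 mul1r.
by congr (- B _ (mode _ _ _)); lia.
Qed.

Lemma mode1_weight1 a b : a \in g -> b \in g -> mode 1 a b = B a b *: vacuum V.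
Proof.
move=> ag bg; have /cftV[l lE] : mode 1 a b \in grade V 0.
  exact: mode_grade ag bg _.
rewrite -[a in B a b]vacuum_creation form_weight1 // opprK lE.
by rewrite linearZr_LR B11 /= mulrN1 opprK.
Qed.

Lemma form_sym a b : a \in g -> b \in g -> B a b = B b a.
Proof.
move=> ag bg; rewrite -[b in LHS]vacuum_creation.
rewrite -[B a _]opprK -[-1]/(- (1 : int)) -form_weight1 // mode1_weight1 //.
by rewrite linearZl_LR B11 /= mulrN1 opprK.
Qed.

Lemma bracket_weight1 a b : a \in g -> b \in g -> mode 0 a b \in g.
Proof. by move=> ag bg; apply: mode_grade ag bg _. Qed.

(** The affine Lie algebra relations: in the commutator formula only [a_(0) b]
    and [a_(1) b = (a|b) 1] are left, the higher products having negative
    degree. *)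
Lemma mode_comm_weight1 a b u m n : a \in g -> b \in g ->
  mode m a (mode n b u) = mode n b (mode m a u) + mode (m + n) (mode 0 a b) u
    + (if m + n == 0 then m%:~R * B a b else 0) *: u.
Proof.
move=> ag bg; apply/eqP; rewrite -addrA addrC -subr_eq.
rewrite (@mode_commutator _ _ 2) => [|j j2]; last first.
  by rewrite (mode_grade_neg ag bg) ?linear0l ?scaler0 //; lia.
rewrite big_ord_recl big_ord1 /= binz0 binz1 scale1r mode1_weight1 //.
rewrite linearZl_LR vacuum_mode subr0 subr_eq addNr scalerA.
by case: ifP; rewrite ?scaler0 ?scale0r.
Qed.

(** The vectors of degree 1 are primary of weight 1. *)
Lemma mode_virasoro_comm a u m n : a \in g ->
  mode n a (L m u) = L m (mode n a u) + n%:~R *: mode (m + n) a u.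
Proof.
move=> ag; have := @mode_commutator _ _ 2 (conformal V) a u (m + 1) n.
rewrite big_ord_recl big_ord1 /= binz0 binz1 scale1r.
rewrite (conformal_weight ag) scale1r conformal_derivation.
have -> : m + 1 + n - 0 - 1 = m + n by lia.
have -> : m + 1 + n - 1 = m + n by lia.
rewrite -scalerDl -rmorphD /= => /(_ _)/eqP.
rewrite subr_eq => /(_ _)/eqP; rewrite /virasoro_op => -> => [|j].
  rewrite addrAC -scalerDl -rmorphD /=.
  have -> : - (m + 1 + n - 0) + (m + 1) + n = 0 by lia.
  by rewrite scale0r add0r.
rewrite leq_eqVlt => /predU1P[<-|j3].
  by rewrite [mode 2 _ _]L1_weight1 // linear0l scaler0.
by rewrite (mode_grade_neg (conformal_grade V) ag) ?linear0l ?scaler0 //; lia.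
Qed.

Lemma bracketC a b : a \in g -> b \in g -> mode 0 a b = - mode 0 b a.
Proof.
move=> ag bg; apply/eqP; rewrite -addr_eq0; apply/eqP.
have := mode_comm_weight1 (vacuum V) 0 (-1) ag bg.
rewrite (mode_comm_weight1 (vacuum V) (-1) 0 bg ag) /= !scale0r !addr0.
rewrite !vacuum_creation => /eqP; rewrite -[X in X == _]addr0.
by rewrite -addrA (inj_eq (addrI _)) addrC => /eqP <-.
Qed.

Lemma bracket_jacobi a b u : a \in g -> b \in g ->
  mode 0 a (mode 0 b u) = mode 0 b (mode 0 a u) + mode 0 (mode 0 a b) u.
Proof.
by move=> ag bg; rewrite mode_comm_weight1 //= addr0 mul0r scale0r addr0.
Qed.

Lemma form_bracket a b u : a \in g -> B (mode 0 a b) u = - B b (mode 0 a u).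
Proof. by move=> ag; rewrite form_weight1. Qed.

End WeightOne.

(** * Four operators on the fourth Casimir element *)

Section FourCurrents.
Context (R : realType) (V : voa R) (B : {biscalar V}).
Context (cftV : cft_type V) (invB : invariant_form B)
  (B11 : B (vacuum V) (vacuum V) = -1).
Implicit Types (a b u v : V).

Local Notation L m := (virasoro_op (V := V) m).
Local Notation g := (grade V 1).
Local Notation D a := (mode 1 a).
Local Notation br a b := (mode 0 a b).

Let bg := @bracket_weight1 R V.

(** Here and in [current_mode], [a_(1)] is moved one step to the right: the
    central term can occur only past [b_(-1)]. *)
Lemma current_vacuum (n : nat) a b : a \in g -> b \in g ->
  D a (mode (- n.+1%:Z) b (vacuum V)) =
  mode (- n%:Z) (br a b) (vacuum V) + (if n == 0 then B a b else 0) *: vacuum V.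
Proof.
move=> ag bg'; rewrite (mode_comm_weight1 cftV invB B11) //.
rewrite vacuum_annihilation //.
rewrite linear0r add0r mul1r.
have -> : 1 + - n.+1%:Z = - n%:Z by lia.
by rewrite oppr_eq0.
Qed.

Lemma current_mode (n : nat) a b u : a \in g -> b \in g ->
  D a (mode (- n.+2%:Z) b u) =
  mode (- n.+2%:Z) b (D a u) + mode (- n.+1%:Z) (br a b) u.
Proof.
move=> ag bg'; rewrite (mode_comm_weight1 cftV invB B11) //.
have -> : 1 + - n.+2%:Z = - n.+1%:Z by lia.
by rewrite /= scale0r addr0.
Qed.

(** An operator [a_(1)] either hits [y], giving the scalar [(a|y)], or enters
    [x_(-k)], giving [[a x]_(-k+1)], with one central term when [k = 1]. In the
    last summand all four operators have entered. *)
Lemma four_currents_casimir_term a1 a2 a3 a4 x y :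
  a1 \in g -> a2 \in g -> a3 \in g -> a4 \in g -> x \in g -> y \in g ->
  D a1 (D a2 (D a3 (D a4 (mode (-3) x y)))) =
  (B a4 y * B a1 (br a2 (br a3 x)) + B a3 y * B a1 (br a2 (br a4 x))
   + B a2 y * B a1 (br a3 (br a4 x)) + B a1 y * B a2 (br a3 (br a4 x))
   + B (br a1 (br a2 (br a3 (br a4 x)))) y) *: vacuum V.
Proof.
move=> g1 g2 g3 g4 xg yg.
have m1 := mode1_weight1 cftV invB B11.
have DZ a l u : D a (l *: u) = l *: D a u by rewrite linearZr_LR.
have MZ n a l u : mode n a (l *: u) = l *: mode n a u by rewrite linearZr_LR.
rewrite (current_mode 1) // (m1 a4 y) // linearDr MZ DZ.
rewrite (current_vacuum 2) // scale0r addr0.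
rewrite (current_mode 0) ?bg // (m1 a3 y) // MZ.
rewrite !linearDr !DZ !(current_vacuum 1) ?bg // !scale0r !addr0.
rewrite !vacuum_creation.
rewrite [D a2 (mode _ _ _)](mode_comm_weight1 cftV invB B11) ?bg //=.
rewrite (m1 a2 y) // MZ vacuum_creation mul1r !linearDr !DZ !m1 ?bg //.
rewrite !scalerA -!scalerDl; congr (_ *: _).
suff -> : B a1 (br (br a2 (br a3 (br a4 x))) y) =
  B (br a1 (br a2 (br a3 (br a4 x)))) y by ring.
set z := (br a2 _); have zg : z \in g by rewrite !bg.
rewrite (bracketC cftV invB B11 g1 zg) linearNl.
by rewrite (form_bracket cftV invB) // opprK.
Qed.

Lemma four_currents_lower4 a1 a2 a3 a4 :
  a1 \in g -> a2 \in g -> a3 \in g -> a4 \in g ->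
  D a1 (D a2 (D a3 (D a4 (L (-4) (vacuum V))))) =
  B a1 (br a2 (br a3 a4)) *: vacuum V.
Proof.
move=> g1 g2 g3 g4.
rewrite (mode_virasoro_comm cftV invB B11) // vacuum_annihilation //.
rewrite [L _ _]linear0r add0r scale1r.
rewrite (current_vacuum 2) // scale0r addr0.
rewrite (current_vacuum 1) ?bg // scale0r addr0 vacuum_creation.
by rewrite (mode1_weight1 cftV invB B11) ?bg.
Qed.

Lemma four_currents_lower22 a1 a2 a3 a4 :
  a1 \in g -> a2 \in g -> a3 \in g -> a4 \in g ->
  D a1 (D a2 (D a3 (D a4 (L (-2) (conformal V))))) =
  (2 * (B a1 a2 * B a3 a4 + B a1 a3 * B a2 a4 + B a1 a4 * B a2 a3)
   + B a1 (br (br a2 a3) a4) + B a1 (br (br a2 a4) a3)) *: vacuum V.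
Proof.
move=> g1 g2 g3 g4.
have m1 := mode1_weight1 cftV invB B11.
have lm m n a u := @mode_virasoro_comm R V B cftV invB B11 a u m n.
have DZ a l u : D a (l *: u) = l *: D a u by rewrite linearZr_LR.
have LZ m l u : L m (l *: u) = l *: L m u by rewrite [L _ _]linearZr_LR.
have Dom a : a \in g -> D a (conformal V) = a.
  move=> ag; rewrite -lower_vacuum lm // vacuum_annihilation //.
  by rewrite [L _ _]linear0r add0r scale1r vacuum_creation.
have D0om a : a \in g -> mode 0 a (conformal V) = 0.
  move=> ag; rewrite -lower_vacuum lm // vacuum_annihilation //.
  by rewrite [L _ _]linear0r add0r scale0r.
rewrite lm // Dom // scale1r linearDr lm // (m1 a3 a4) // LZ.
rewrite lower_vacuum scale1r (_ : -2 + 1 = -1) //.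
rewrite [D a3 (mode _ _ _)](mode_comm_weight1 cftV invB B11) //=.
rewrite Dom // D0om ?bg // addr0 mul1r !linearDr !DZ !Dom //.
rewrite ![D a2 (mode _ _ _)](mode_comm_weight1 cftV invB B11) //=.
rewrite !mul1r (m1 a2 a3) // (m1 a2 a4) //.
rewrite !linearZr_LR /= !vacuum_creation !linearDr !DZ !m1 ?bg //.
rewrite !scalerA -!scalerDl; congr (_ *: _); ring.
Qed.

Lemma dual_basis_expand d (x y : 'I_d -> V) a : dual_basis g B x y -> a \in g ->
  a = \sum_j B a (y j) *: x j.
Proof.
move=> [[xg x_span _] _ xy] /x_span[l ->]; apply: eq_bigr => j _.
congr (_ *: _); rewrite linear_sumlz (bigD1 j) //= big1.
  by rewrite addr0 linearZl_LR xy eqxx; apply/esym/mulr1.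
by move=> i ij; rewrite linearZl_LR xy (negbTE ij); exact: mulr0.
Qed.

Lemma dual_basis_sum d (x y : 'I_d -> V) (f : {linear V -> V}) a b :
  dual_basis g B x y -> a \in g ->
  \sum_j B a (y j) * B b (f (x j)) = B b (f a).
Proof.
move=> xy ag; rewrite {2}(dual_basis_expand xy ag) !linear_sum /=.
by apply: eq_bigr => j _; rewrite linearZ linearZr_LR.
Qed.

(** Of the four terms of [four_currents_casimir_term] that contain scalar
    pairings, the first two cancel because [[a4 a3] = - [a3 a4]]. *)
Lemma four_currents_casimir d (x y : 'I_d -> V) a1 a2 a3 a4 :
  dual_basis g B x y -> a1 \in g -> a2 \in g -> a3 \in g -> a4 \in g ->
  D a1 (D a2 (D a3 (D a4 (casimir x y 4)))) =
  (\sum_j B (br a1 (br a2 (br a3 (br a4 (x j))))) (y j)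
   + B a1 (br a3 (br a4 a2)) + B a2 (br a3 (br a4 a1))) *: vacuum V.
Proof.
move=> xy g1 g2 g3 g4; have [[xg _ _] [yg _ _] _] := xy.
rewrite /casimir !linear_sumr /=.
under eq_bigr do rewrite (four_currents_casimir_term g1 g2 g3 g4 (xg _) (yg _)).
rewrite -scaler_suml; congr (_ *: _); rewrite !big_split /=.
rewrite (dual_basis_sum (mode 0 a2 \o mode 0 a3) a1 xy g4).
rewrite (dual_basis_sum (mode 0 a2 \o mode 0 a4) a1 xy g3).
rewrite (dual_basis_sum (mode 0 a3 \o mode 0 a4) a1 xy g2).
rewrite (dual_basis_sum (mode 0 a3 \o mode 0 a4) a2 xy g1) /=.
rewrite [br a4 a3](bracketC cftV invB B11) // !linearNr subrr.
by rewrite add0r addrC addrA.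
Qed.

(** [L(m) b] has negative degree for [m > 1], so only the commutator of [L(m)]
    with the mode of [a] is left. *)
Lemma virasoro_op_pair m n a b : a \in g -> b \in g -> 1 < m ->
  L m (mode n a b) = (- n)%:~R *: mode (m + n) a b.
Proof.
move=> ag bg' m1; have := mode_virasoro_comm cftV invB B11 b m n ag.
rewrite [L m b](mode_grade_neg (conformal_grade V) bg') ?linear0r; last by lia.
by move=> /esym/eqP; rewrite addr_eq0 => /eqP ->; rewrite rmorphN scaleNr.
Qed.

Lemma casimir4_L4 d (x y : 'I_d -> V) : dual_basis g B x y ->
  L 4 (casimir x y 4) = (3 * d%:R) *: vacuum V.
Proof.
move=> [[xg _ _] [yg _ _] xy]; rewrite /casimir [L _ _]linear_sumr.
rewrite (eq_bigr (fun=> 3 *: vacuum V)) => [|j _].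
  by rewrite sumr_const card_ord -scaler_nat scalerA mulrC.
rewrite [mode _ _ (mode _ _ _)](virasoro_op_pair _ (xg j) (yg j)) //.
by rewrite (mode1_weight1 cftV invB B11) // xy eqxx scale1r.
Qed.

Lemma casimir4_L22 d (x y : 'I_d -> V) : dual_basis g B x y ->
  L 2 (L 2 (casimir x y 4)) = (3 * d%:R) *: vacuum V.
Proof.
move=> [[xg _ _] [yg _ _] xy]; rewrite /casimir.
rewrite [L 2 (\sum_(_ < _) _)]linear_sumr.
rewrite [L _ _]linear_sumr.
rewrite (eq_bigr (fun=> 3 *: vacuum V)) => [|j _].
  by rewrite sumr_const card_ord -scaler_nat scalerA mulrC.
rewrite [mode _ _ (mode (1 - _) _ _)](virasoro_op_pair _ (xg j) (yg j)) //.
rewrite linearZr_LR /=.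
rewrite [mode _ _ (mode _ _ _)](virasoro_op_pair _ (xg j) (yg j)) //.
by rewrite (mode1_weight1 cftV invB B11) // xy eqxx !scale1r.
Qed.

Lemma form_bracketA a b u : a \in g -> b \in g -> B a (br b u) = B (br a b) u.
Proof.
move=> ag bg'; rewrite (bracketC cftV invB B11 ag bg') linearNl.
by rewrite (form_bracket cftV invB) // opprK.
Qed.

(** The Jacobi identity, paired with [a1]. *)
Lemma bracket_pairing_jacobi a1 a2 a3 a4 :
  a1 \in g -> a2 \in g -> a3 \in g -> a4 \in g ->
  B (br a1 a3) (br a2 a4) = B (br a1 a2) (br a3 a4) + B (br a1 a4) (br a2 a3).
Proof.
move=> g1 g2 g3 g4; have skew := bracketC cftV invB B11.
rewrite -(form_bracketA _ g1 g2) (bracket_jacobi cftV invB B11) // linearDr.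
rewrite (form_bracketA _ g1 g3) [br (br a2 a3) _]skew ?bg // linearNr.
by rewrite (form_bracketA _ g1 g4) subrK.
Qed.

End FourCurrents.


(** * The trace formula *)

Theorem theorem3p6 (R : realType) (V : voa R) (B : {biscalar V})
    (d : nat) (x y : 'I_d -> V) :
  cft_type V ->
  invariant_form B ->
  nondegenerate_form B ->
  B (vacuum V) (vacuum V) = -1 ->
  dual_basis (grade V 1) B x y ->
  (0 < d)%N ->
  central_charge V <> 0 ->
  central_charge V <> - (22 / 5) ->
  casimir x y 4 \in conformal_sub_voa_grade V 4 ->
  let c := central_charge V in
  forall a1 a2 a3 a4 : V,
    a1 \in grade V 1 -> a2 \in grade V 1 ->
    a3 \in grade V 1 -> a4 \in grade V 1 ->
    subspace_trace (grade V 1)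
      (fun v => mode 0 a1 (mode 0 a2 (mode 0 a3 (mode 0 a4 v)))) =
    (1 + 3 * d%:R * (c - 2) / (c * (22 + 5 * c)))
      * B (mode 0 a1 a2) (mode 0 a3 a4)
    + (2 - 24 * d%:R / (c * (22 + 5 * c)))
      * B (mode 0 a1 a4) (mode 0 a2 a3)
    + 24 * d%:R / (c * (22 + 5 * c))
      * (B a1 a2 * B a3 a4 + B a1 a3 * B a2 a4 + B a1 a4 * B a2 a3).
Proof.
move=> cftV invB _ B11 xy _ /eqP c0 c225 /conformal_sub_voa_grade4 kE c.
move=> a1 a2 a3 a4 g1 g2 g3 g4.
have bg a b : a \in grade V 1 -> b \in grade V 1 -> mode 0 a b \in grade V 1.
  exact: bracket_weight1.
have [bx _ xyE] := xy.
rewrite -/c in c0 c225.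
have c225' : 22 + 5 * c != 0.
  apply/eqP => c_eq; apply: c225; rewrite -[c](mulKf (x := 5)) ?pnatr_eq0 //.
  by rewrite -[5 * c](addKr 22) c_eq addr0; field.
have vac_inj (p q : R[i]) : p *: vacuum V = q *: vacuum V -> p = q.
  move=> /(congr1 (fun v => B v (vacuum V))).
  by rewrite !linearZl_LR B11 /= !mulrN1 => /oppr_inj.
have -> := @subspace_trace_dual _ _ _ B
  (mode 0 a1 \o (mode 0 a2 \o (mode 0 a3 \o mode 0 a4))) d x y bx xyE _.
2: by move=> u ug /=; rewrite !bg.
rewrite /=; move: kE => [al [be kE]].
(* Two linear equations, E1 and E2, for the coefficients al and be. *)
have := casimir4_L4 cftV invB B11 xy.
rewrite kE [virasoro_op _ _]linearDr !linearZr_LR /=.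
rewrite [mode _ _ (virasoro_op (-2) _)]L4_lower22.
rewrite [mode _ _ (virasoro_op (-4) _)]L4_lower4.
rewrite !scalerA -scalerDl => /vac_inj E1.
have := casimir4_L22 cftV invB B11 xy.
rewrite kE [virasoro_op 2 (_ + _)]linearDr !linearZr_LR /=.
rewrite [virasoro_op 2 _]linearDr !linearZr_LR /=.
rewrite [mode _ _ (mode _ _ (virasoro_op (-2) _))]L22_lower22.
rewrite [mode _ _ (mode _ _ (virasoro_op (-4) _))]L22_lower4.
rewrite !scalerA -scalerDl => /vac_inj E2.
(* The two values of the product of the a_(1) on the Casimir element. *)
have := four_currents_casimir cftV invB B11 xy g1 g2 g3 g4.
rewrite kE !linearDr !linearZr_LR /=.
rewrite (four_currents_lower22 cftV invB B11) //.
rewrite (four_currents_lower4 cftV invB B11) //.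
rewrite !scalerA -scalerDl => /vac_inj.
set T := \sum_j _.
have skew := bracketC cftV invB B11; have ad := form_bracketA cftV invB B11.
rewrite [mode 0 (mode 0 a2 a3) a4]skew ?bg //.
rewrite [mode 0 (mode 0 a2 a4) a3]skew ?bg // !linearNr.
rewrite (ad _ _ _ g1 g2) (ad _ _ _ g2 g3) (ad _ _ _ g1 g4) !(ad _ _ _ g1 g3).
rewrite [mode 0 a4 a2]skew // [mode 0 a4 a1]skew // !linearNr.
rewrite [B (mode 0 a2 a3) _](form_sym cftV invB B11) ?bg //.
rewrite (bracket_pairing_jacobi cftV invB B11 g1 g2 g3 g4).
move: (B (mode 0 a1 a2) _) (B (mode 0 a1 a4) _) => P Q.
(* Cramer's rule: be drops out of 10 E2 - 6 E1, and al of (8 + c) E1 - 6 E2. *)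
rewrite -/c in E1 E2; have cc0 : c * (22 + 5 * c) != 0 by rewrite mulf_neq0.
have -> : al = 12 * d%:R / (c * (22 + 5 * c)).
  apply: (mulIf cc0); rewrite divfK //.
  have -> : al * (c * (22 + 5 * c)) = 10 * (3 * d%:R) - 6 * (3 * d%:R).
    by rewrite -{1}E2 -E1; field.
  by ring.
have -> : be = 3 * d%:R * (2 + c) / (c * (22 + 5 * c)).
  apply: (mulIf cc0); rewrite divfK //.
  have -> : be * (c * (22 + 5 * c)) = (8 + c) * (3 * d%:R) - 6 * (3 * d%:R).
    by rewrite -{1}E1 -E2; field.
  by ring.
move=> /esym/(canRL (addrK _))/(canRL (addrK _)) ->.
by move: (22 + 5 * c) c225' => s s0; field; rewrite s0 c0.
Qed.
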